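(* Let $p:\mathbb{R}^N\times\mathbb{R}^N\to(1,\infty)$ be continuous and symmetric, with $1<p^-:=\inf p\le p^+:=\sup p<\infty$, and put $\bar p(x)=p(x,x)$. Let $u\in C^2_c(\mathbb{R}^N)$. Then $$\lim_{s\nearrow 1}(1-s)\,J_{s,p(\cdot,\cdot)}(u)=\int_{\mathbb{R}^N}\frac{2}{\bar p(x)}|\partial_1u(x)|^{\bar p(x)}\,dx .$$
   Context: For $s\in(0,1)$, with $e_1$ the first canonical vector of $\mathbb{R}^N$, $$J_{s,p(\cdot,\cdot)}(u)=\int_{\mathbb{R}^N}\int_{\mathbb{R}}\frac{|u(x+he_1)-u(x)|^{p(x,x+he_1)}}{|h|^{1+s\,p(x,x+he_1)}}\,dh\,dx .$$ Symmetric means $p(x,y)=p(y,x)$ for all $x,y\in\mathbb{R}^N$. *)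

(* Defs.v *)
From HB Require Import structures.
From mathcomp Require Import all_boot all_order all_algebra.
From mathcomp Require Import all_classical all_reals all_analysis.
Import Order.TTheory GRing.Theory Num.Theory.
Import numFieldNormedType.Exports.

Set Implicit Arguments.
Unset Strict Implicit.
Unset Printing Implicit Defensive.

Local Open Scope classical_set_scope.
Local Open Scope ring_scope.

(* R^n is 'rV[R]_n, with the product sigma-algebra, i.e. the one generated by
   the coordinate maps, as the library does for n.-tuple T. *)
Definition measure_rV_display : measure_display -> measure_display.
Proof. exact. Qed.

Section measurable_rV.
Context {d} {T : sigmaRingType d}.
Variable n : nat.

Let coors : 'I_n -> 'rV[T]_n -> T := fun i x => x ord0 i.

Let rV_set0 : g_sigma_preimage coors set0.
Proof. exact: sigma_algebra0. Qed.

Let rV_setC A : g_sigma_preimage coors A -> g_sigma_preimage coors (~` A).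
Proof. exact: sigma_algebraC. Qed.

Let rV_bigcup (F : _^nat) : (forall i, g_sigma_preimage coors (F i)) ->
  g_sigma_preimage coors (\bigcup_i (F i)).
Proof. exact: sigma_algebra_bigcup. Qed.

HB.instance Definition _ := @isMeasurable.Build (measure_rV_display d)
  'rV[T]_n (g_sigma_preimage coors) rV_set0 rV_setC rV_bigcup.

Lemma measurable_coord (i : 'I_n) :
  measurable_fun [set: 'rV[T]_n] (fun x : 'rV[T]_n => x ord0 i).
Proof.
move=> _ Y mY; rewrite setTI; apply: sub_sigma_algebra => /=.
rewrite -bigcup_seq/=; exists i => /=; first by rewrite mem_index_enum.
by exists Y => //; rewrite setTI.
Qed.

Lemma measurable_fun_rV d1 (T1 : measurableType d1) (f : T1 -> 'rV[T]_n) :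
  (forall i, measurable_fun [set: T1] (fun x => f x ord0 i)) ->
  measurable_fun [set: T1] f.
Proof.
move=> mf _ Y mY; move: Y mY.
suff : (@measurable _ 'rV[T]_n) `<=` [set Y | measurable (f @^-1` Y)].
  by move=> + Y mY; rewrite setTI => /(_ Y mY).
apply: smallest_sub.
  split=> /=; first by rewrite preimage_set0.
  - by move=> A mA; rewrite setTD preimage_setC; exact: measurableC.
  - by move=> F mF; rewrite preimage_bigcup; exact: bigcupT_measurable.
rewrite -bigcup_seq => A [i /= _ [B mB <-]] /=.
by rewrite setTI -comp_preimage -[X in measurable X]setTI; exact: mf.
Qed.

End measurable_rV.

Section lebesgue_measure_rV.
Context {R : realType}.
Local Open Scope ereal_scope.

Definition cons_rV n (z : measurableTypeR R * 'rV[R]_n) : 'rV[R]_n.+1 :=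
  row_mx (const_mx z.1 : 'rV[R]_1) z.2.

Definition uncons_rV n (x : 'rV[R]_n.+1) : measurableTypeR R * 'rV[R]_n :=
  (x ord0 ord0, \row_i x ord0 (lift ord0 i)).

Lemma cons_rV0 n z : @cons_rV n z ord0 ord0 = z.1.
Proof.
by rewrite mxE; case: splitP => [j _|//]; rewrite mxE.
Qed.

Lemma cons_rVS n z i : @cons_rV n z ord0 (lift ord0 i) = z.2 ord0 i.
Proof.
rewrite mxE; case: splitP => [j /= ij|j /= [] /val_inj ->//].
by have := ltn_ord j; rewrite -ij.
Qed.

Lemma cons_rVK n : cancel (@cons_rV n) (@uncons_rV n).
Proof.
move=> [t x]; rewrite /uncons_rV cons_rV0; congr pair.
by apply/rowP => i; rewrite mxE cons_rVS.
Qed.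

Lemma measurable_cons_rV n : measurable_fun setT (@cons_rV n).
Proof.
apply: measurable_fun_rV => i; case: (unliftP ord0 i) => [j ->|->].
  rewrite (_ : (fun _ => _) = (fun x : 'rV[R]_n => x ord0 j) \o snd).
    apply: measurableT_comp; [exact: measurable_coord|exact: measurable_snd].
  by apply/funext => z /=; rewrite cons_rVS.
rewrite (_ : (fun _ => _) = fst); first exact: measurable_fst.
by apply/funext => z /=; rewrite cons_rV0.
Qed.

Lemma measurable_uncons_rV n : measurable_fun setT (@uncons_rV n).
Proof.
apply: measurable_fun_pair; first exact: measurable_coord.
apply: measurable_fun_rV => i; under eq_fun do rewrite mxE.
exact: measurable_coord.
Qed.

Section cons_measure.
Variables (n : nat) (mu : {sigma_finite_measure set 'rV[R]_n -> \bar R}).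

Definition cons_measure : set 'rV[R]_n.+1 -> \bar R :=
  pushforward (lebesgue_measure \x mu) (@cons_rV n).

HB.instance Definition _ := Measure.copy cons_measure
  (measure_function_pushforward__canonical__measure_function_Measure
     (lebesgue_measure \x mu) (@measurable_cons_rV n)).

Let cons_measure_sigma_finite : sigma_finite setT cons_measure.
Proof.
have /sigma_finiteP[F [TF ndF Foo]] :=
  sigma_finiteT (@lebesgue_measure R : {sigma_finite_measure set _ -> \bar _}).
have /sigma_finiteP[G [TG ndG Goo]] := sigma_finiteT mu.
exists (fun k => (@uncons_rV n) @^-1` (F k `*` G k)).
  rewrite -preimage_bigcup (_ : \bigcup_k _ = setT) ?preimage_setT//.
  apply/seteqP; split=> // -[x y] _.
  have : setT x by []. rewrite TF => -[i _ Fix].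
  have : setT y by []. rewrite TG => -[j _ Gjy].
  exists (maxn i j) => //; split => /=.
    by move: x Fix; exact/subsetPset/ndF/leq_maxl.
  by move: y Gjy; exact/subsetPset/ndG/leq_maxr.
move=> k; have [mF Fk] := Foo k; have [mG Gk] := Goo k; split.
  rewrite -[X in measurable X]setTI; apply: measurable_uncons_rV => //.
  exact: measurableX.
rewrite /cons_measure /pushforward -comp_preimage.
rewrite (_ : _ \o _ = id); last by apply/funext => z /=; rewrite cons_rVK.
by rewrite preimage_id product_measure1E// lte_mul_pinfty// ge0_fin_numE.
Qed.

HB.instance Definition _ := Measure_isSigmaFinite.Build _ _ _ cons_measure
  cons_measure_sigma_finite.

End cons_measure.

(* Lebesgue measure on R^n, as the n-fold product of the one on R. *)
Fixpoint lebesgue_measure_rV n : {sigma_finite_measure set 'rV[R]_n -> \bar R} :=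
  match n with
  | 0 => \d_(0%R : 'rV[R]_0)
  | n'.+1 => cons_measure (lebesgue_measure_rV n')
  end.

Lemma lebesgue_measure_rV_box n (A : 'I_n -> set (measurableTypeR R)) :
  (forall i, measurable (A i)) ->
  lebesgue_measure_rV n [set x | forall i, A i (x ord0 i)] =
  \prod_(i < n) lebesgue_measure (A i).
Proof.
elim: n A => [|n IH] A mA /=.
  by rewrite big_ord0 diracE mem_set//= => -[].
rewrite big_ord_recl -IH// -product_measure1E//; last first.
  rewrite [X in measurable X](_ : _ = \bigcap_(i in [set: 'I_n])
    ((fun x : 'rV[R]_n => x ord0 i) @^-1` A (lift ord0 i))).
    apply: fin_bigcap_measurable => // i _.
    by rewrite -[X in measurable X]setTI; apply: measurable_coord; last exact: mA.
  by apply/seteqP; split=> [x Ax i _|x Ax i]; [exact: Ax|exact: (Ax i)].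
rewrite /cons_measure /pushforward; congr (_ _).
apply/seteqP; split=> [z /= Az|z /= [A0 AS] i].
  by split=> [|i]; [rewrite -cons_rV0|rewrite -cons_rVS]; exact: Az.
by case: (unliftP ord0 i) => [j ->|->]; rewrite ?cons_rVS ?cons_rV0.
Qed.

End lebesgue_measure_rV.

Section functional.
Context {R : realType}.

Fixpoint continuously_differentiable n (k : nat) (u : 'rV[R]_n -> R) : Prop :=
  match k with
  | 0 => continuous u
  | k'.+1 => continuous u /\
      forall i : 'I_n, (forall x, derivable u x (delta_mx ord0 i)) /\
        continuously_differentiable k' ('D_(delta_mx ord0 i) u)
  end.

Definition compactly_supported n (u : 'rV[R]_n -> R) : Prop :=
  compact (closure [set x | u x != 0]).

Definition e1 n : 'rV[R]_n.+1 := delta_mx ord0 ord0.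

(* The integrand at h = 0 has the junk value 0; {0} is Lebesgue-negligible. *)
Definition J n (s : R) (p : 'rV[R]_n.+1 -> 'rV[R]_n.+1 -> R)
    (u : 'rV[R]_n.+1 -> R) : \bar R :=
  (\int[lebesgue_measure_rV n.+1]_x \int[lebesgue_measure]_h
    (let y := x + (h : R) *: e1 n in
     `|u y - u x| `^ p x y / `|h : R| `^ (1 + s * p x y))%:E)%E.

End functional.

(* Main.v *)
Require Import Defs.
From HB Require Import structures.
From mathcomp Require Import all_boot all_order all_algebra.
From mathcomp Require Import all_classical all_reals all_analysis.
From mathcomp Require Import measurable_realfun lra ring.
Import Order.TTheory GRing.Theory Num.Theory.
Import numFieldNormedType.Exports.

Set Implicit Arguments.
Unset Strict Implicit.
Unset Printing Implicit Defensive.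

Local Open Scope classical_set_scope.
Local Open Scope ring_scope.

(** Fix x and look at the inner integral along the line through x in the
direction e1. With D h = |u(x + h e1) - u(x)| and q h = p(x, x + h e1), the
integrand at h != 0 is

  (D h / |h|) ^ (q h) * |h| ^ ((1 - s) * q h - 1)      (lemma [kernE]).

The weight (1 - s) |h|^((1 - s) q - 1) has mass 2 d^((1 - s) q) / q on
{0 < |h| <= d}, which tends to 2 / q as s increases to 1 whatever d is: it
concentrates at h = 0. There the first factor tends to |d_1 u(x)|^(p(x, x))
and the exponent q h tends to p(x, x) by continuity of p. Freezing both on a
small interval up to an error e, and letting first s -> 1 and then e -> 0,
gives the limit of the inner integral at every point x
([cvg_integral_kern], [cvg_slice]).

The outer integral is then handled by dominated convergence, which needs a
majorant in x that does not depend on s. This is where 1 < inf p enters: for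
s >= 1 / inf p the product s * p is at least 1, so the kernel decays at least
like |h|^-2 at infinity. If x is far from the support of u in the direction
e1, only increments h comparable to the first coordinate x_1 contribute, and
the inner integral is O(1 / (1 + x_1^2)); if another coordinate of x leaves
the box containing the support, it vanishes; elsewhere it is bounded because
u is bounded and Lipschitz along e1 ([slice_le_majorant]). The resulting
majorant is integrable by Tonelli ([integrable_majorant]).

All the integrals are meaningful because continuous functions are measurable
for the product sigma-algebra, which is generated by countably many boxes
([measurable_fun_continuous_rV2]). *)

(** * Measurability of continuous functions and of variable powers *)

(** An open set is the union of the members of a countable basis that it
contains, so measurability only has to be checked on the basis. The map [phi]
separates the space that carries the sigma-algebra from the one that carries
the topology. *)
Lemma measurable_preimage_open d (X : measurableType d) (Y : topologicalType)
    (I : countType) (B : I -> set Y) (phi : X -> Y) :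
  (forall i, measurable (phi @^-1` B i)) ->
  (forall y U, nbhs y U -> exists2 i, B i y & B i `<=` U) ->
  forall U : set Y, open U -> measurable (phi @^-1` U).
Proof.
move=> mB basisB U openU.
rewrite (_ : phi @^-1` U = \bigcup_(i in [set i | B i `<=` U]) phi @^-1` B i).
  rewrite -[X in measurable X]setTI.
  have -> : [set: X] `&` \bigcup_(i in [set i | B i `<=` U]) phi @^-1` B i =
    \bigcup_i (if asbool (B i `<=` U) then phi @^-1` B i else set0).
    rewrite setTI; apply/seteqP; split=> [x [i /= BU Bx]|x [i _]].
      by exists i => //; rewrite asboolT.
    by case: asboolP => // BU Bx; exists i.
  by apply: countable_bigcupT_measurable => // i; case: ifP.
apply/seteqP; split=> [x /= Ux|x [i /= BU Bx]]; last exact: BU.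
have /basisB[i Bi BU] : nbhs (phi x) U by rewrite nbhsE; exists U.
by exists i.
Qed.

Section continuous_measurable_rV.
Context {R : realType} (m : nat).

Definition rational_box (i : 'rV[rat]_m * nat) : set 'rV[R]_m :=
  [set x | forall j, `|x ord0 j - ratr (i.1 ord0 j)| < i.2.+1%:R^-1].

Lemma rational_box_sub_ball (x : 'rV[R]_m) (e : R) : 0 < e ->
  exists2 i, rational_box i x & rational_box i `<=` ball x e.
Proof.
move=> e0; pose k := Num.truncn (2 / e).
have ke : 2 / e < k.+1%:R by rewrite truncnS_gt.
have k0 : 0 < k.+1%:R^-1 :> R by rewrite invr_gt0.
have k2e : k.+1%:R^-1 + k.+1%:R^-1 < e.
  by rewrite -mulr2n -[X in X < _]mulr_natl ltr_pdivrMr// mulrC -ltr_pdivrMr.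
have approx j : exists q : rat, `|x ord0 j - ratr q| < k.+1%:R^-1.
  have /rat_in_itvoo[q] : x ord0 j - k.+1%:R^-1 < x ord0 j + k.+1%:R^-1.
    by rewrite ltrBlDr -addrA ltrDl addr_gt0.
  rewrite in_itv/= => /andP[q1 q2]; exists q.
  by rewrite ltr_distlC; apply/andP; split.
have [q qx] := choice approx.
exists (\row_j q j, k) => [j|y /= ky]; first by rewrite /= mxE.
split=> // i j; rewrite !(ord1 i) /ball/=.
rewrite -(subrKA (ratr (q j))) (le_lt_trans (ler_normD _ _))//.
apply: lt_trans k2e; apply: ltrD; first exact: qx.
by rewrite distrC; have := ky j; rewrite mxE.
Qed.

(** Two arguments are allowed so that the lemma covers p(x, x + h e1) as a
function of (x, h); products of rational boxes are a countable basis of the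
product topology. *)
Lemma measurable_fun_continuous_rV2 d (X : measurableType d)
    (f : 'rV[R]_m * 'rV[R]_m -> R) (a b : X -> 'rV[R]_m) :
  continuous f ->
  (forall j, measurable_fun setT (fun z => a z ord0 j)) ->
  (forall j, measurable_fun setT (fun z => b z ord0 j)) ->
  measurable_fun setT (fun z => f (a z, b z)).
Proof.
move=> cf ma mb.
have mbox (c : X -> 'rV[R]_m) i :
    (forall j, measurable_fun setT (fun z => c z ord0 j)) ->
    measurable (c @^-1` rational_box i).
  move=> mc; rewrite [X in measurable X](_ : _ = \bigcap_(j in [set: 'I_m])
    ((fun z => `|c z ord0 j - ratr (i.1 ord0 j)|) @^-1` `]-oo, i.2.+1%:R^-1[)).
    apply: fin_bigcap_measurable => // j _.
    rewrite -[X in measurable X]setTI.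
    have mcj : measurable_fun setT
        (fun z => `|c z ord0 j - ratr (i.1 ord0 j)|).
      by apply: measurableT_comp => //; exact: measurable_funB.
    exact: mcj.
  by apply/seteqP; split=> [z /= cz j _ /=|z /= cz j];
    [rewrite in_itv/= cz|have := cz j I; rewrite /= in_itv].
apply: (measurability _ (RGenOpens.measurableE R)).
move=> _ [_ [p [q ->] <-]]; rewrite setTI.
pose B (i : ('rV[rat]_m * nat) * ('rV[rat]_m * nat)) :=
  rational_box i.1 `*` rational_box i.2.
apply: (@measurable_preimage_open _ X _ _ B (fun z => (a z, b z))
  _ _ (f @^-1` `]p, q[)).
- by move=> i; apply: measurableI; exact: mbox.
- move=> [x y] U /nbhs_ballP[e /= e0 eU].
  have [i ix ixe] := rational_box_sub_ball x e0.
  have [j jy jye] := rational_box_sub_ball y e0.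
  exists (i, j) => // -[x' y'] [/= ix' jy'].
  by apply: eU; split; [exact: ixe|exact: jye].
- by apply: open_comp => [z _|]; [exact: cf|exact: interval_open].
Qed.

End continuous_measurable_rV.

Lemma measurable_fun_powR2 d (X : measurableType d) (R : realType)
    (a b : X -> R) :
  measurable_fun setT a -> measurable_fun setT b ->
  measurable_fun setT (fun z => a z `^ b z).
Proof.
move=> ma mb; rewrite /powR; apply: measurable_fun_ifT => //.
- exact: measurable_fun_eqr.
- by apply: measurableT_comp => //; apply: measurable_fun_eqr.
- apply: measurableT_comp => //; apply: measurable_funM => //.
  exact: measurableT_comp.
Qed.

Lemma measurable_quotient d (X : measurableType d) (R : realType)
    (D q h : X -> R) (s : R) :
  measurable_fun setT D -> measurable_fun setT q -> measurable_fun setT h ->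
  measurable_fun setT (fun z => D z `^ q z / `|h z| `^ (1 + s * q z)).
Proof.
move=> mD mq mh; under eq_fun do rewrite -powRN.
apply: measurable_funM; first exact: measurable_fun_powR2.
apply: measurable_fun_powR2; first exact: measurableT_comp.
apply: measurableT_comp => //; apply: measurable_funD => //.
exact: measurable_funM.
Qed.

(** Joint continuity of the power a ^ b at a base that may be 0: there the
exponents being at least 1 forces a_t ^ b_t <= a_t once a_t <= 1. *)
Lemma cvg_powR2 (R : realType) (T : Type) (F : set_system T) {FF : Filter F}
    (f g : T -> R) (a b : R) :
  (\forall t \near F, 0 <= f t) -> (\forall t \near F, 1 <= g t) ->
  0 <= a -> 1 <= b ->
  f t @[t --> F] --> a -> g t @[t --> F] --> b ->
  (f t `^ g t) @[t --> F] --> a `^ b.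
Proof.
move=> f0 g1; rewrite le_eqVlt => /predU1P[<-|a0] b1 fa gb.
  rewrite powR0; last by rewrite gt_eqF// (lt_le_trans ltr01).
  apply: (@squeeze_cvgr _ _ _ _ (cst 0) f) => //; last exact: cvg_cst.
  near=> t; rewrite powR_ge0/=.
  have ft1 : f t <= 1 by near: t; apply: cvgr_le fa _ _; exact: ltr01.
  have := near f0 t; have := near g1 t => /(_ _)/wrap[//|gt1] /(_ _)/wrap[//|].
  rewrite le_eqVlt => /predU1P[<-|ft0].
    by rewrite powR0// gt_eqF// (lt_le_trans ltr01).
  by apply: ge1r_powR => //; rewrite ft0.
rewrite {2}/powR gt_eqF//.
have : expR (g t * ln (f t)) @[t --> F] --> expR (b * ln a).
  apply: continuous_cvg; first exact: continuous_expR.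
  apply: cvgM => //; apply: continuous_cvg => //; exact: continuous_ln.
apply: cvg_trans; apply: near_eq_cvg; near=> t.
rewrite /powR gt_eqF//; near: t; exact: cvgr_gt fa _ _.
Unshelve. all: by end_near. Qed.

(** * Integrals of powers around the origin *)

Section line_integrals.
Context {R : realType}.
Local Notation mu := (@lebesgue_measure R).

Lemma integralT_oneDsqrV :
  (\int[mu]_h ((oneDsqr h)^-1)%:E = pi%:E)%E.
Proof.
rewrite ge0_symfun_integralT.
- rewrite -set_itvcy integral0y_oneDsqr -EFinM; congr EFin.
  by rewrite mulrC divfK.
- by move=> h; rewrite invr_ge0.
- exact: continuous_oneDsqrV.
- by move=> h; rewrite /= /oneDsqr sqrrN.
Qed.

Definition punctured_ball (d : R) : set R := [set h | 0 < `|h| <= d].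

Lemma measurable_punctured_ball (d : R) : measurable (punctured_ball d).
Proof.
rewrite (_ : punctured_ball d = (@Num.norm _ R) @^-1` `]0, d]).
  by rewrite -[X in measurable X]setTI; exact: normr_measurable.
by apply/seteqP; split=> h; rewrite /punctured_ball/= in_itv.
Qed.

Definition annulus (a d : R) : set R := [set h | a <= `|h| <= d].

Lemma annulusE (a d : R) : 0 < a ->
  annulus a d = `[- d, - a] `|` `[a, d].
Proof.
move=> a0; apply/seteqP; split=> [h|h []]; rewrite /annulus/= ?in_itv/=.
- have [h0|h0] := leP 0 h; first by rewrite ger0_norm//; right.
  rewrite ltr0_norm// => /andP[ah hd]; left; apply/andP; split; lra.
- move=> /andP[dh ha]; rewrite ler0_norm; [apply/andP; split|]; lra.
- by move=> /andP[ah hd]; rewrite ger0_norm; [apply/andP|lra].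
Qed.

Lemma measurable_annulus (a d : R) : measurable (annulus a d).
Proof.
rewrite (_ : annulus a d = (@Num.norm _ R) @^-1` `[a, d]).
  by rewrite -[X in measurable X]setTI; exact: normr_measurable.
by apply/seteqP; split=> h; rewrite /annulus/= in_itv.
Qed.

Lemma measurable_normr_powR (b : R) :
  measurable_fun [set: R] (fun h => `|h| `^ b).
Proof. by apply: measurable_fun_powR2 => //; exact: measurableT_comp. Qed.

Lemma continuous_powRl (b h : R) : 0 < h -> {for h, continuous (@powR R ^~ b)}.
Proof.
move=> h0; apply/differentiable_continuous/derivable1_diffP/derivable_powR.
by rewrite in_itv/= andbT.
Qed.

Lemma integral_itv_powR (a d b : R) : 0 < a -> a < d -> 0 < b ->
  (\int[mu]_(h in `[a, d]) (h `^ (b - 1))%:E = ((d `^ b - a `^ b) / b)%:E)%E.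
Proof.
move=> a0 ad b0.
rewrite (@continuous_FTC2 _ _ (fun h => h `^ b / b))//.
- by rewrite -EFinB mulrBl.
- apply: continuous_in_subspaceT => h; rewrite inE/= in_itv/= => /andP[ah _].
  by apply: continuous_powRl; exact: lt_le_trans ah.
- have cont (h : R) : 0 < h -> {for h, continuous (fun h => h `^ b / b)}.
    by move=> h0; apply: cvgM; [exact: continuous_powRl|exact: cvg_cst].
  split.
  + move=> h; rewrite in_itv/= => /andP[ah _]; apply: derivableM => //.
    by apply: derivable_powR; rewrite in_itv/= andbT (lt_trans a0).
  + by apply: cvg_at_right_filter; exact: cont.
  + by apply: cvg_at_left_filter; apply: cont; exact: lt_trans ad.
- move=> h; rewrite in_itv/= => /andP[ah _].
  have h0 : h \in `]0, +oo[ by rewrite in_itv/= andbT (lt_trans a0).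
  rewrite derive1E deriveM//; last exact: derivable_powR.
  rewrite derive_cst scaler0 add0r -derive1E powR_derive1// scalerAl.
  by rewrite /GRing.scale/= mulVf ?mul1r// gt_eqF.
Qed.

Lemma integral_annulus_powR (a d b : R) : 0 < a -> a < d -> 0 < b ->
  (\int[mu]_(h in annulus a d) (`|h| `^ (b - 1))%:E =
   (2 * (d `^ b - a `^ b) / b)%:E)%E.
Proof.
move=> a0 ad b0; rewrite annulusE// ge0_integral_setU//=; last 2 first.
- apply/measurable_EFinP; apply: measurable_funTS.
  exact: measurable_normr_powR.
- apply/disj_setPS => h [/=]; rewrite !in_itv/= => /andP[? ?] /andP[? ?]; lra.
have pos : (\int[mu]_(h in `[a, d]) (`|h| `^ (b - 1))%:E =
    ((d `^ b - a `^ b) / b)%:E)%E.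
  rewrite -integral_itv_powR//; apply: eq_integral => h.
  rewrite inE/= in_itv/= => /andP[ah _].
  by rewrite ger0_norm// (le_trans (ltW a0)).
rewrite (@integration_by_substitution_oppr _ (fun h => `|h| `^ (b - 1)))//.
- under eq_integral do rewrite /= normrN.
  by rewrite pos -EFinD -mulr2n -mulrA mulr_natl.
- exact: ltW.
- apply: continuous_in_subspaceT => h; rewrite inE/= in_itv/= => /andP[_ ha].
  apply: (@continuous_comp _ _ _ (@Num.norm _ R) (fun y => y `^ (b - 1))).
    exact: norm_continuous.
  by apply: continuous_powRl; rewrite normr_gt0; lra.
Qed.

(** For b < 1 the integrand blows up at 0, so the fundamental theorem of
calculus is applied on annuli that exhaust the punctured ball. *)
Lemma integral_punctured_ball_powR (d b : R) : 0 < d -> 0 < b ->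
  (\int[mu]_(h in punctured_ball d) (`|h| `^ (b - 1))%:E =
   (2 * d `^ b / b)%:E)%E.
Proof.
move=> d0 b0.
(* Starting at d / 2 keeps the inner radius below d in every annulus. *)
pose F (k : nat) := annulus (d / k.+2%:R) d.
have FU : punctured_ball d = \bigcup_k F k.
  apply/seteqP; split=> [h /= /andP[h0 hd]|h [k _ /= /andP[h1 h2]]].
    exists (Num.truncn (d / `|h|)) => //=; rewrite /F/annulus/= hd andbT.
    rewrite ler_pdivrMr// mulrC -ler_pdivrMr//.
    by rewrite ltW// (lt_trans (truncnS_gt _))// ltr_nat.
  by rewrite /punctured_ball/= h2 andbT (lt_le_trans _ h1)// divr_gt0.
have ndF : nondecreasing_seq F.
  move=> k l kl; apply/subsetPset => h; rewrite /F/annulus/= => /andP[h1 ->].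
  rewrite andbT; apply: le_trans h1; rewrite ler_pM2l// lef_pV2 ?posrE//.
  by rewrite ler_nat.
have mF k : measurable (F k) by exact: measurable_annulus.
have mf k : measurable_fun (F k) (fun h : R => (`|h| `^ (b - 1))%:E).
  by apply/measurable_EFinP; apply: measurable_funTS;
    exact: measurable_normr_powR.
have f0 k h : F k h -> (0 <= (`|h| `^ (b - 1))%:E)%E.
  by rewrite lee_fin powR_ge0.
have := @ge0_nondecreasing_set_cvg_integral _ (measurableTypeR R) R F
  (fun h => (`|h| `^ (b - 1))%:E) mu ndF mF mf f0.
rewrite -FU => cvgF; apply/esym; apply: cvg_unique cvgF => //.
rewrite (_ : (fun k => _) =
    (fun k => (2 * (d `^ b - (d / k.+2%:R) `^ b) / b)%:E)); last first.
  apply/funext => k; apply: integral_annulus_powR => //; first exact: divr_gt0.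
  by rewrite ltr_pdivrMr// ltr_pMr// ltr1n.
apply: cvg_EFin; first exact: nearW.
rewrite [X in _ --> X](_ : _ = 2 * (d `^ b - 0) / b); last by rewrite subr0.
apply: cvgM; last exact: cvg_cst.
apply: cvgM; first exact: cvg_cst.
apply: cvgB; first exact: cvg_cst.
move/cvg_at_rightP : (powR_cvg0 b0); apply; split=> [k|]; first exact: divr_gt0.
rewrite -[X in _ --> X](mulr0 d); apply: cvgM; first exact: cvg_cst.
have := @cvg_harmonic R; rewrite -(cvg_shiftS (@harmonic R)); exact.
Qed.

(** The two bounds below turn pointwise information on a kernel into bounds
that are explicit in the exponent b. The tail is compared with 1 / (1 + h^2),
whose integral over the line is pi. *)
Lemma integral_le_powR_oneDsqr (k : R -> R) (c b d C : R) :
  0 <= c -> 0 < b -> 0 < d -> 0 <= C ->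
  measurable_fun setT k -> (forall h, 0 <= k h) -> k 0 = 0 ->
  (forall h, 0 < `|h| <= d -> k h <= c * `|h| `^ (b - 1)) ->
  (forall h, d < `|h| -> k h <= C / oneDsqr h) ->
  (\int[mu]_h (k h)%:E <= (c * (2 * d `^ b / b) + C * pi)%:E)%E.
Proof.
move=> c0 b0 d0 C0 mk k0 k00 knear kfar.
pose S : set (measurableTypeR R) := punctured_ball d.
have mS : measurable S by exact: measurable_punctured_ball.
have mkE : measurable_fun [set: measurableTypeR R] (fun h => (k h)%:E).
  exact/measurable_EFinP.
rewrite -(setUv S) ge0_integral_setU//=; last 4 first.
- exact: measurableC.
- by rewrite setUv.
- by move=> h _; rewrite lee_fin.
- exact/disj_setPCl.
rewrite EFinD; apply: leeD.
  rewrite EFinM -integral_punctured_ball_powR//.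
  rewrite -ge0_integralZl_EFin//; last first.
    apply/measurable_EFinP; apply: measurable_funTS.
    exact: measurable_normr_powR.
  apply: ge0_le_integral => //.
  - by move=> h _; rewrite lee_fin.
  - exact: measurable_funTS.
  - apply/measurable_EFinP; apply: measurable_funTS.
    apply: measurable_funM => //.
    exact: measurable_normr_powR.
have moneD : measurable_fun [set: R] (fun h : R => (oneDsqr h)^-1).
  by apply: continuous_measurable_fun; exact: continuous_oneDsqrV.
rewrite EFinM -integralT_oneDsqrV -ge0_integralZl_EFin//; last first.
  exact/measurable_EFinP.
have mfar : measurable_fun [set: R] (fun h : R => (C%:E * (oneDsqr h)^-1%:E)%E).
  by apply/measurable_EFinP; exact: measurable_funM.
have far0 h : (0 <= C%:E * ((oneDsqr h)^-1)%:E :> \bar R)%E.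
  by rewrite -EFinM lee_fin mulr_ge0// invr_ge0.
apply: (@le_trans _ _
  (\int[mu]_(h in ~` S) (C%:E * (oneDsqr h)^-1%:E))%E); last first.
  by apply: ge0_subset_integral => //; exact: measurableC.
apply: ge0_le_integral => //.
- exact: measurableC.
- by move=> h _; rewrite lee_fin.
- exact: measurable_funTS.
- exact: measurable_funTS.
- move=> h /= /negP; rewrite negb_and -leNgt normr_le0 -ltNge.
  move=> /orP[/eqP->|dh].
    by rewrite k00.
  by rewrite -EFinM lee_fin; exact: kfar.
Qed.

Lemma integral_ge_powR (k : R -> R) (c b d : R) :
  0 <= c -> 0 < b -> 0 < d ->
  measurable_fun setT k -> (forall h, 0 <= k h) ->
  (forall h, 0 < `|h| <= d -> c * `|h| `^ (b - 1) <= k h) ->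
  ((c * (2 * d `^ b / b))%:E <= \int[mu]_h (k h)%:E)%E.
Proof.
move=> c0 b0 d0 mk k0 knear.
pose S : set (measurableTypeR R) := punctured_ball d.
have mS : measurable S by exact: measurable_punctured_ball.
have mkE : measurable_fun [set: measurableTypeR R] (fun h => (k h)%:E).
  exact/measurable_EFinP.
apply: (@le_trans _ _ (\int[mu]_(h in S) (k h)%:E)%E); last first.
  by apply: ge0_subset_integral => // h _; rewrite lee_fin.
rewrite EFinM -integral_punctured_ball_powR//.
rewrite -ge0_integralZl_EFin//; last first.
  apply/measurable_EFinP; apply: measurable_funTS.
  exact: measurable_normr_powR.
apply: ge0_le_integral => //.
- by move=> h _; rewrite mule_ge0// lee_fin powR_ge0.
- apply/measurable_EFinP; apply: measurable_funTS; apply: measurable_funM => //.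
  exact: measurable_normr_powR.
- exact: measurable_funTS.
Qed.

End line_integrals.

(** * The one-dimensional limit *)

Section slice.
Context {R : realType}.
Local Notation mu := (@lebesgue_measure R).

(** [D h] stands for |u(x + h e1) - u(x)| and [q h] for p(x, x + h e1), with
x fixed. The constant [L] bounds both [D h] and its Lipschitz ratio, and [s0]
is a lower bound on s above which s * q is at least 1. *)
Variables (D q : R -> R) (L P s0 : R).
Hypotheses (mD : measurable_fun setT D) (mq : measurable_fun setT q).
Hypotheses (L1 : 1 <= L) (s0_gt0 : 0 < s0).
Hypotheses (D_ge0 : forall h, 0 <= D h) (D_lip : forall h, D h <= L * `|h|)
  (D_le : forall h, D h <= L).
Hypotheses (q_ge1 : forall h, 1 <= q h) (q_le : forall h, q h <= P)
  (s0q : forall h, 1 <= s0 * q h).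

Definition kern (s h : R) := D h `^ q h / `|h| `^ (1 + s * q h).

Let q_gt0 h : 0 < q h. Proof. exact: lt_le_trans (q_ge1 h). Qed.
Let P1 : 1 <= P. Proof. exact: le_trans (q_ge1 0) (q_le 0). Qed.
Let L0 : 0 < L. Proof. exact: lt_le_trans L1. Qed.

Let D0 : D 0 = 0.
Proof.
by apply/eqP; rewrite eq_le D_ge0 andbT (le_trans (D_lip 0))// normr0 mulr0.
Qed.

Lemma kern_ge0 s h : 0 <= kern s h.
Proof. by rewrite divr_ge0// powR_ge0. Qed.

Lemma kern0 s : kern s 0 = 0.
Proof. by rewrite /kern D0 powR0 ?mul0r// gt_eqF. Qed.

Lemma measurable_kern s : measurable_fun setT (kern s).
Proof. exact: measurable_quotient. Qed.

Lemma kernE s h : h != 0 ->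
  kern s h = (D h / `|h|) `^ q h * `|h| `^ ((1 - s) * q h - 1).
Proof.
move=> h0; have nh0 : 0 < `|h| by rewrite normr_gt0.
have -> : kern s h = (D h / `|h| * `|h|) `^ q h / `|h| `^ (1 + s * q h).
  by rewrite divfK// gt_eqF.
rewrite powRM ?divr_ge0// -(mulrA (_ `^ _)); congr (_ * _).
rewrite -powRB; last by apply/implyP => _; rewrite gt_eqF.
by congr (_ `^ _); ring.
Qed.

(** The Lipschitz bound leaves |h| to the power (1 - s) q - 1, and for
|h| <= 1 the case q = 1 dominates. The bound has an integral of
order 1 / (1 - s) over the unit ball, which the factor 1 - s compensates. *)
Lemma kern_le_near s h : 0 < s < 1 -> 0 < `|h| <= 1 ->
  kern s h <= L `^ P * `|h| `^ ((1 - s) - 1).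
Proof.
move=> /andP[s_gt0 s_lt1] h01; have /andP[h0 h1] := h01.
rewrite kernE -?normr_gt0//; apply: ler_pM; rewrite ?powR_ge0//.
  apply: (@le_trans _ _ (L `^ q h)); last exact: ler_powR.
  apply: ge0_ler_powR; rewrite ?nnegrE ?divr_ge0//; first exact: ltW.
  - exact: ltW.
  - by rewrite ler_pdivrMr.
apply: ger_powR => //; rewrite lerD2r ler_peMr// subr_ge0; exact: ltW.
Qed.

(** Beyond |h| = 1 the hypothesis s * q >= 1 gives a decay in |h|^-2. Between
d and 1 the kernel is only bounded, at the price of the factor
d^(-(1 + P)); that factor does not depend on s, so it is killed by 1 - s. *)
Lemma kern_le_far s h d : s0 <= s -> s < 1 -> 0 < d <= 1 -> d < `|h| ->
  kern s h <= L `^ P * (d `^ (- (1 + P)) * 2) / oneDsqr h.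
Proof.
move=> s0s s1 /andP[d0 d1] dh; have h0 : 0 < `|h| := lt_trans d0 dh.
have sq1 : 1 <= s * q h.
  by apply: le_trans (s0q h) _; rewrite ler_pM2r.
have sqP : s * q h <= P.
  apply: le_trans (q_le h); rewrite ler_piMl ?ltW//.
rewrite /kern -mulrA; apply: ler_pM; rewrite ?powR_ge0 ?invr_ge0 ?powR_ge0//.
  apply: (@le_trans _ _ (L `^ q h)); last exact: ler_powR.
  by apply: ge0_ler_powR; rewrite ?nnegrE// ltW.
rewrite powRN.
have dP : 0 < d `^ (1 + P) by exact: powR_gt0.
have o0 : 0 < oneDsqr h by rewrite (lt_le_trans ltr01)// oneDsqr_ge1.
have w0 : 0 < `|h| `^ (1 + s * q h) by exact: powR_gt0.
rewrite -mulrA -invf_div -invfM lef_pV2 ?posrE ?mulr_gt0 ?divr_gt0//.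
(* Both cases compare |h|^(1 + s q) with d^(1 + P) * (1 + h^2) / 2. *)
have [h1|h1] := leP 1 `|h|.
  apply: (@le_trans _ _ (`|h| `^ 2)); last by apply: ler_powR => //; lra.
  rewrite powR_mulrn// real_normK ?num_real//.
  have h2 : 1 <= h ^+ 2 by rewrite -real_normK ?num_real// exprn_ege1.
  have dP1 : d `^ (1 + P) <= 1.
    by rewrite -[leRHS](powRr0 d); apply: ger_powR; rewrite ?d0//; lra.
  apply: (@le_trans _ _ (1 * (oneDsqr h / 2))).
    by apply: ler_pM; rewrite ?powR_ge0 ?divr_ge0 ?(ltW o0).
  by rewrite /oneDsqr; lra.
apply: (@le_trans _ _ (`|h| `^ (1 + P))); last first.
  by apply: ger_powR; [rewrite h0 ltW|lra].
apply: (@le_trans _ _ (d `^ (1 + P) * 1)).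
  rewrite ler_pM2l// ler_pdivrMr// mul1r /oneDsqr.
  have : h ^+ 2 <= 1 by rewrite -real_normK ?num_real// expr_le1// ltW.
  lra.
rewrite mulr1; apply: ge0_ler_powR; rewrite ?nnegrE; try exact: ltW.
by lra.
Qed.

(** The bound is uniform in s although the integral itself may blow up
as s -> 1; it serves as the majorant for points near the support. *)
Lemma integral_kern_le s : s0 <= s -> s < 1 ->
  ((1 - s)%:E * \int[mu]_h (kern s h)%:E <= (2 * L `^ P * (1 + pi))%:E)%E.
Proof.
move=> s0s s1.
have s_gt0 : 0 < s by exact: lt_le_trans s0s.
have s'0 : 0 < 1 - s by rewrite subr_gt0.
have LP0 : 0 <= L `^ P by exact: powR_ge0.
have pi0 : 0 <= pi :> R by exact: pi_ge0.
have near_le h : 0 < `|h| <= 1 -> kern s h <= L `^ P * `|h| `^ ((1 - s) - 1).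
  by apply: kern_le_near; rewrite s_gt0.
have far_le h : 1 < `|h| -> kern s h <= (L `^ P * 2) / oneDsqr h.
  move=> h1; have := @kern_le_far s h 1 s0s s1.
  by rewrite powR1 mul1r; apply => //; rewrite ltr01 lexx.
have LP2 : 0 <= L `^ P * 2 by rewrite mulr_ge0.
have kle := integral_le_powR_oneDsqr LP0 s'0 ltr01 LP2 (measurable_kern s)
  (kern_ge0 s) (kern0 s) near_le far_le.
apply: le_trans (lee_wpmul2l _ kle) _; first by rewrite lee_fin ltW.
rewrite -EFinM lee_fin powR1 mulr1 mulrDr.
rewrite (_ : (1 - s) * (L `^ P * (2 / (1 - s))) = 2 * L `^ P); last first.
  by field; rewrite gt_eqF.
rewrite [leRHS]mulrDr [in leRHS]mulr1 lerD2l (mulrC (L `^ P)).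
rewrite ler_piMl ?mulr_ge0//; lra.
Qed.

(** Here t is the first coordinate of x and M bounds the support of u: the
increment from x is nonzero only if x + h e1 falls in the support, that is on
an interval of length 2 M on which |h| >= |t| / 2 >= 1. *)
Lemma integral_kern_le_far s t M : s0 <= s -> s < 1 -> 1 <= M ->
  2 * M < `|t| -> (forall h, M < `|t + h| -> D h = 0) ->
  ((1 - s)%:E * \int[mu]_h (kern s h)%:E <=
   (L `^ P * (4 / t ^+ 2) * (2 * M))%:E)%E.
Proof.
move=> s0s s1 M1 Mt D0far.
have M0 : 0 < M by exact: lt_le_trans M1.
have t0 : 0 < `|t| by rewrite (lt_trans _ Mt)// mulr_gt0.
have t20 : 0 < t ^+ 2 by rewrite -real_normK ?num_real// exprn_gt0.
pose I : set (measurableTypeR R) := `[- t - M, - t + M]%classic.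
pose c := L `^ P * (4 / t ^+ 2).
have c0 : 0 <= c by rewrite mulr_ge0 ?powR_ge0// divr_ge0// ltW.
have kern_le_indic h : kern s h <= c * \1_I h.
  have [th|th] := leP `|t + h| M; last first.
    by rewrite /kern D0far// powR0 ?gt_eqF// mul0r mulr_ge0.
  have -> : \1_I h = 1 :> R.
    rewrite indicE mem_set// /I/= in_itv/=.
    by move: th; rewrite ler_norml => /andP[? ?]; apply/andP; split; lra.
  have ht2 : `|t| / 2 <= `|h|.
    have := ler_normB (t + h) h; rewrite addrK; lra.
  have h1 : 1 <= `|h| by lra.
  have sq1 : 1 <= s * q h by apply: le_trans (s0q h) _; rewrite ler_pM2r.
  rewrite mulr1; apply: ler_pM; rewrite ?powR_ge0 ?invr_ge0 ?powR_ge0//.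
    apply: (@le_trans _ _ (L `^ q h)); last exact: ler_powR.
    by apply: ge0_ler_powR; rewrite ?nnegrE// ltW.
  rewrite -invf_div lef_pV2 ?posrE ?divr_gt0 ?powR_gt0//; last first.
    exact: lt_le_trans h1.
  apply: (@le_trans _ _ (`|h| `^ 2)); last by apply: ler_powR => //; lra.
  rewrite powR_mulrn// -(real_normK (num_real t)).
  have -> : `|t| ^+ 2 / 4 = (`|t| / 2) ^+ 2 by field.
  by rewrite lerXn2r ?nnegrE// ltW// divr_gt0.
have mI : measurable I by exact: measurable_itv.
have kle : (\int[mu]_h (kern s h)%:E <= (c * (2 * M))%:E)%E.
  have -> : (c * (2 * M))%:E = (\int[mu]_h (c%:E * (\1_I h)%:E))%E.
    rewrite ge0_integralZl_EFin//; last exact/measurable_EFinP.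
    rewrite integral_indic// setIT.
    rewrite [X in (_ * X)%E](_ : _ = (2 * M)%:E) ?EFinM//.
    apply: (etrans (@lebesgue_measure_itv R `[- t - M, - t + M])).
    rewrite /= lte_fin.
    by rewrite ltrD2l gtrN// -EFinB; congr EFin; ring.
  apply: ge0_le_integral => //.
  - by move=> h _; rewrite lee_fin kern_ge0.
  - by apply/measurable_EFinP; exact: measurable_kern.
  - by apply/measurable_EFinP; apply: measurable_funM.
  - by move=> h _; rewrite lee_fin; exact: kern_le_indic.
apply: le_trans kle; rewrite -[leRHS]mul1e; apply: lee_wpmul2r.
  by apply: integral_ge0 => h _; rewrite lee_fin kern_ge0.
by rewrite lee_fin gerBl (le_trans (ltW s0_gt0)).
Qed.

Variables (a q0 : R).
Hypotheses (Da : D h / `|h| @[h --> 0^'] --> a) (qq0 : q h @[h --> 0^'] --> q0).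

Let a0 : 0 <= a.
Proof. by apply: (cvgr_to_ge Da); apply: nearW => h; rewrite divr_ge0. Qed.

Let q01 : 1 <= q0.
Proof. by apply: (cvgr_to_ge qq0); apply: nearW. Qed.

Let A := a `^ q0.
Let A0 : 0 <= A. Proof. exact: powR_ge0. Qed.

(* The integrals over the ball of radius d, after multiplication by 1 - s,
   with (D h / |h|)^(q h) replaced by a^q0 + e (resp. a^q0 - e, cut at 0) and
   the exponent q h by q0 - e (resp. q0 + e). The upper one also contains the
   tail. *)
Let upper (d e s : R) := (A + e) * (2 * d `^ ((1 - s) * (q0 - e)) / (q0 - e))
   + (1 - s) * (L `^ P * (d `^ (- (1 + P)) * 2) * pi).

Let lower (d e s : R) := Num.max (A - e) 0 *
    (2 * d `^ ((1 - s) * (q0 + e)) / (q0 + e)).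

(* For 0 < |h| <= d <= 1 a larger exponent gives a smaller power, hence q0 - e
   in the upper bound and q0 + e in the lower one. *)
Let kern_sandwich (e : R) : 0 < e < 1 -> exists2 d, 0 < d & forall s,
  s0 <= s -> s < 1 ->
  ((lower d e s)%:E <= (1 - s)%:E * \int[mu]_h (kern s h)%:E <=
   (upper d e s)%:E)%E.
Proof.
move=> /andP[e0 e1].
have q0e : 0 < q0 + e by rewrite addr_gt0// (lt_le_trans ltr01).
have q0Ne : 0 < q0 - e by rewrite subr_gt0 (lt_le_trans e1).
have rA : ((D h / `|h|) `^ q h) @[h --> 0^'] --> A.
  apply: cvg_powR2 => //; first by apply: nearW => h; rewrite divr_ge0.
  exact: nearW.
have : \forall h \near 0^', `|A - (D h / `|h|) `^ q h| <= e /\ `|q0 - q h| <= e.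
  near=> h; split; near: h.
    by move/cvgrPdist_le : rA; exact.
  by move/cvgrPdist_le : qq0; exact.
move=> [d1 /= d10 near0].
pose d := Num.min (d1 / 2) 1.
have d0 : 0 < d by rewrite lt_min ltr01 divr_gt0.
have d1' : d <= 1 by rewrite ge_min lexx orbT.
have {}near0 h : 0 < `|h| <= d ->
    `|A - (D h / `|h|) `^ q h| <= e /\ `|q0 - q h| <= e.
  move=> /andP[h0 hd]; apply: near0; last by rewrite -normr_gt0.
  rewrite /ball_/= sub0r normrN (le_lt_trans hd)// gt_min.
  by rewrite ltr_pdivrMr// ltr_pMr// ltr1n.
exists d => // s s0s s1.
have s'0 : 0 < 1 - s by rewrite subr_gt0.
have expo (h x y : R) : 0 < `|h| <= d -> x <= y ->
    `|h| `^ ((1 - s) * y - 1) <= `|h| `^ ((1 - s) * x - 1).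
  move=> /andP[h0 hd] xy; apply: ger_powR; first by rewrite h0 (le_trans hd).
  by rewrite lerD2r ler_pM2l.
have hn0 (h : R) : 0 < `|h| <= d -> h != 0.
  by move=> /andP[h0 _]; rewrite -normr_gt0.
apply/andP; split.
  have c0 : 0 <= Num.max (A - e) 0 by rewrite le_max lexx orbT.
  have b0 : 0 < (1 - s) * (q0 + e) by rewrite mulr_gt0.
  have near_ge h : 0 < `|h| <= d ->
      Num.max (A - e) 0 * `|h| `^ ((1 - s) * (q0 + e) - 1) <= kern s h.
    move=> hd; have [rh qh] := near0 _ hd; rewrite kernE ?hn0//.
    apply: ler_pM; rewrite ?powR_ge0//.
      by rewrite ge_max powR_ge0 andbT; move: rh; rewrite ler_distl; lra.
    by apply: expo => //; move: qh; rewrite ler_distl; lra.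
  have le_k :=
    integral_ge_powR c0 b0 d0 (measurable_kern s) (kern_ge0 s) near_ge.
  apply: le_trans (lee_wpmul2l _ le_k); last by rewrite lee_fin ltW.
  rewrite -EFinM lee_fin /lower le_eqVlt; apply/orP; left; apply/eqP.
  by field; rewrite !gt_eqF.
have c0 : 0 <= A + e by rewrite addr_ge0// ltW.
have b0 : 0 < (1 - s) * (q0 - e) by rewrite mulr_gt0.
have C0 : 0 <= L `^ P * (d `^ (- (1 + P)) * 2) by rewrite !mulr_ge0// powR_ge0.
have near_le h : 0 < `|h| <= d ->
    kern s h <= (A + e) * `|h| `^ ((1 - s) * (q0 - e) - 1).
  move=> hd; have [rh qh] := near0 _ hd; rewrite kernE ?hn0//.
  apply: ler_pM; rewrite ?powR_ge0//.
    by move: rh; rewrite ler_distl; lra.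
  by apply: expo => //; move: qh; rewrite ler_distl; lra.
have far_le h : d < `|h| ->
    kern s h <= L `^ P * (d `^ (- (1 + P)) * 2) / oneDsqr h.
  by move=> dh; apply: kern_le_far => //; rewrite d0.
have k_le := integral_le_powR_oneDsqr c0 b0 d0 C0 (measurable_kern s)
  (kern_ge0 s) (kern0 s) near_le far_le.
apply: le_trans (lee_wpmul2l _ k_le) _; first by rewrite lee_fin ltW.
rewrite -EFinM lee_fin /upper le_eqVlt; apply/orP; left; apply/eqP.
by field; rewrite !gt_eqF.
Unshelve. all: by end_near. Qed.

Let cvg_powR_onem (d x : R) : 0 < d ->
  d `^ ((1 - s) * x) @[s --> 1^'-] --> (1 : R).
Proof.
move=> d0; rewrite (_ : (fun s => _) = (fun s => expR ((1 - s) * x * ln d))).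
  2: by apply/funext => s; rewrite /powR gt_eqF.
rewrite -[X in _ --> X]expR0.
apply: continuous_cvg; first exact: continuous_expR.
rewrite -[X in _ --> X](mul0r (ln d)); apply: cvgM; last exact: cvg_cst.
rewrite -[X in _ --> X](mul0r x); apply: cvgM; last exact: cvg_cst.
rewrite -[X in _ --> X](subrr 1); apply: cvgB; first exact: cvg_cst.
exact: cvg_at_left_filter.
Qed.

Let cvg_upper (d e : R) : 0 < d ->
  upper d e s @[s --> 1^'-] --> (A + e) * (2 / (q0 - e)).
Proof.
move=> d0; rewrite -[X in _ --> X]addr0; apply: cvgD.
  apply: cvgM; first exact: cvg_cst.
  apply: cvgM; last exact: cvg_cst.
  rewrite -[X in _ --> X]mulr1; apply: cvgM; first exact: cvg_cst.
  exact: cvg_powR_onem.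
rewrite -[X in _ --> X](mul0r (L `^ P * (d `^ (- (1 + P)) * 2) * pi)).
apply: cvgM; last exact: cvg_cst.
rewrite -[X in _ --> X](subrr 1); apply: cvgB; first exact: cvg_cst.
exact: cvg_at_left_filter.
Qed.

Let cvg_lower (d e : R) : 0 < d ->
  lower d e s @[s --> 1^'-] --> Num.max (A - e) 0 * (2 / (q0 + e)).
Proof.
move=> d0; apply: cvgM; first exact: cvg_cst.
apply: cvgM; last exact: cvg_cst.
rewrite -[X in _ --> X]mulr1; apply: cvgM; first exact: cvg_cst.
exact: cvg_powR_onem.
Qed.

(** As s -> 1 the bounds of the sandwich tend to max(a^q0 - e, 0) * 2 / (q0 + e)
and (a^q0 + e) * 2 / (q0 - e) whatever d is; e is therefore chosen first,
then d, then s. *)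
Lemma cvg_integral_kern :
  s0 < 1 ->
  ((1 - s)%:E * \int[mu]_h (kern s h)%:E)%E @[s --> 1^'-] -->
  (2 / q0 * a `^ q0)%:E.
Proof.
rewrite -/A => s01.
pose f s := ((1 - s)%:E * \int[mu]_h (kern s h)%:E)%E.
have near_s0 : \forall s \near 1^'-, s0 <= s < 1.
  near=> s; apply/andP; split; near: s; last exact: nbhs_left_lt.
  exact: nbhs_left_ge.
have fin_f s : s0 <= s < 1 -> f s \is a fin_num.
  move=> /andP[s0s s1]; rewrite ge0_fin_numE.
    by rewrite (le_lt_trans (integral_kern_le s0s s1))// ltry.
  rewrite mule_ge0//; first by rewrite lee_fin subr_ge0 ltW.
  by apply: integral_ge0 => h _; rewrite lee_fin kern_ge0.
apply/fine_cvgP; split; first by near=> s; apply: fin_f; near: s.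
apply/cvgrPdist_le => eta eta0.
have cvg_e_id (x : R) : x + e @[e --> 0^'+] --> x.
  rewrite -[X in _ --> X]addr0; apply: cvgD; first exact: cvg_cst.
  exact: cvg_at_right_filter.
have cvg_e_idN (x : R) : x - e @[e --> 0^'+] --> x.
  rewrite -[X in _ --> X]subr0; apply: cvgB; first exact: cvg_cst.
  exact: cvg_at_right_filter.
have lE : 2 / q0 * A = A * (2 / q0) by rewrite mulrC.
have q0n0 : q0 != 0 by rewrite gt_eqF// (lt_le_trans ltr01).
have cvg_up : (A + e) * (2 / (q0 - e)) @[e --> 0^'+] --> 2 / q0 * A.
  rewrite lE; apply: cvgM => //; apply: cvgM; first exact: cvg_cst.
  exact: cvgV.
have cvg_low : Num.max (A - e) 0 * (2 / (q0 + e)) @[e --> 0^'+] --> 2 / q0 * A.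
  rewrite lE; apply: cvgM; last by apply: cvgM; [exact: cvg_cst|exact: cvgV].
  apply: (@squeeze_cvgr _ _ _ _ (fun e => A - e) (cst A)) => //; last first.
    exact: cvg_cst.
  near=> e; rewrite le_max lexx/= ge_max A0 andbT gerBl.
  by near: e; exact: nbhs_right_ge.
have [e e01 [elow eup]] : exists2 e : R, 0 < e < 1 &
    2 / q0 * A - eta < Num.max (A - e) 0 * (2 / (q0 + e)) /\
    (A + e) * (2 / (q0 - e)) < 2 / q0 * A + eta.
  near (0 : R)^'+ => e; exists e.
    by apply/andP; split; near: e; [exact: nbhs_right_gt|exact: nbhs_right_lt].
  split; near: e.
    by apply: cvgr_gt cvg_low _ _; lra.
  by apply: cvgr_lt cvg_up _ _; lra.
have [d d0 sandwich] := kern_sandwich e01.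
near=> s.
have s01' : s0 <= s < 1 by near: s.
have /andP[s0s s1] := s01'.
have := sandwich s s0s s1; rewrite -/(f s) -(fineK (fin_f _ s01')) !lee_fin.
have : 2 / q0 * A - eta < lower d e s.
  by near: s; exact: (cvgr_gt _ (@cvg_lower d e d0) _ elow).
have : upper d e s < 2 / q0 * A + eta.
  by near: s; exact: (cvgr_lt _ (@cvg_upper d e d0) _ eup).
move=> upe lowe /andP[lowf fup]; rewrite ler_distl; apply/andP; split.
  by rewrite lerBlDr (le_trans fup)// ltW.
by rewrite -lerBlDr (le_trans _ lowf)// ltW.
Unshelve. all: by end_near. Qed.

End slice.

(** * Compactly supported functions of class C^2 *)

Lemma compactly_supported_bounded (R : realType) (T : topologicalType)
    (f : T -> R) (K : set T) :
  continuous f -> compact K -> (forall x, ~ K x -> f x = 0) ->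
  exists2 B, 0 < B & forall x, `|f x| <= B.
Proof.
move=> cf cK f0.
have : compact (f @` K).
  by apply: continuous_compact => //; exact: continuous_subspaceT.
move/compact_bounded => [B0 [_ B0P]].
have B1 : B0 < `|B0| + 1 by rewrite (le_lt_trans (ler_norm _))// ltrDl.
exists (`|B0| + 1); first by rewrite ltr_wpDl.
move=> x; have [Kx|nKx] := pselect (K x).
  by apply: B0P => //; exists x.
by rewrite f0// normr0 addr_ge0.
Qed.

Section regular_function.
Context {R : realType} (n : nat) (u : 'rV[R]_n.+1 -> R).
Hypotheses (u_C2 : continuously_differentiable 2 u)
  (u_compact : compactly_supported u).
Local Notation e1 := (@e1 R n).

Lemma C2_continuous : continuous u.
Proof. by case: u_C2. Qed.

Lemma C2_derivable x : derivable u x e1.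
Proof. by case: u_C2 => _ /(_ ord0)[]. Qed.

Lemma C2_continuous_partial : continuous ('D_e1 u).
Proof. by case: u_C2 => _ /(_ ord0)[_ []]. Qed.

Let supp := closure [set x | u x != 0].

Let u_eq0 x : ~ supp x -> u x = 0.
Proof.
move=> sx; apply: contrapT => ux; apply: sx; apply: subset_closure.
by apply/eqP.
Qed.

Let partial_eq0 x : ~ supp x -> 'D_e1 u x = 0.
Proof.
move=> sx; have <- : 'D_e1 (cst (0 : R)) x = 0 by exact: derive_cst.
apply: near_eq_derive.
have : open (~` supp) by rewrite openC; exact: closed_closure.
rewrite openE => /(_ _ sx); apply: filterS => y.
exact: u_eq0.
Qed.

Lemma support_in_box : exists2 M, 1 <= M &
  forall x, u x != 0 -> forall i, `|x ord0 i| <= M.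
Proof.
have [B [_ BP]] := compact_bounded u_compact.
have B1 : B < `|B| + 1 by rewrite (le_lt_trans (ler_norm _))// ltrDl.
exists (`|B| + 1); first by rewrite lerDr.
move=> x ux i; have /(BP _ B1) : supp x by exact: subset_closure.
apply: le_trans; rewrite [leRHS]/Num.norm/= mx_normrE.
exact: (le_bigmax _ (fun ij => `|x ij.1 ij.2|) (ord0, i)).
Qed.

Lemma C2_bounded : exists2 B, 0 < B & forall x, `|u x| <= B.
Proof.
exact: compactly_supported_bounded C2_continuous u_compact u_eq0.
Qed.

Lemma partial_bounded : exists2 B, 0 < B & forall x, `|'D_e1 u x| <= B.
Proof.
exact:
  compactly_supported_bounded C2_continuous_partial u_compact partial_eq0.
Qed.

Lemma is_derive_line x (t : R) :
  is_derive t 1 (fun h => u (x + h *: e1)) ('D_e1 u (x + t *: e1)).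
Proof.
have E : (fun h : R =>
    h^-1 *: (((fun h => u (x + h *: e1)) \o shift t) (h *: (1 : R))
    - u (x + t *: e1))) =
  (fun h => h^-1 *: ((u \o shift (x + t *: e1)) (h *: e1) - u (x + t *: e1))).
  apply/funext => h /=; congr (_ *: (u _ - _)).
  by rewrite /GRing.scale/= mulr1 -/(GRing.scale _ _) scalerDl addrCA.
apply: DeriveDef.
  by rewrite /derivable E; exact: C2_derivable.
by rewrite /derive E.
Qed.

Lemma lipschitz_line B x (h : R) : (forall x, `|'D_e1 u x| <= B) ->
  `|u (x + h *: e1) - u x| <= B * `|h|.
Proof.
move=> BP.
pose g := fun h : R => u (x + h *: e1).
have cg : continuous g.
  move=> t; apply/differentiable_continuous/derivable1_diffP.
  have H := is_derive_line x t. case: H => dg _; exact: dg.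
have key (a b : R) : a <= b -> `|g b - g a| <= B * (b - a).
  move=> ab; have [c _ ->] := @MVT_segment R g (fun t => 'D_e1 u (x + t *: e1))
    a b ab (fun t _ => is_derive_line x t) (continuous_subspaceT cg).
  rewrite normrM (ger0_norm (_ : 0 <= b - a)) ?subr_ge0//.
  by rewrite ler_wpM2r ?subr_ge0.
have -> : u x = g 0 by rewrite /g scale0r addr0.
have [h0|h0] := leP 0 h.
  by have := key _ _ h0; rewrite subr0 (ger0_norm h0).
by have := key _ _ (ltW h0); rewrite sub0r distrC (ltr0_norm h0).
Qed.

Lemma cvg_difference_quotient x :
  `|u (x + h *: e1) - u x| / `|h| @[h --> (0 : R)^'] --> `|'D_e1 u x|.
Proof.
have := @C2_derivable x; rewrite /derivable => /cvg_norm.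
apply: cvg_trans; apply: near_eq_cvg; near=> h.
by rewrite /= normrZ normfV mulrC (addrC x).
Unshelve. all: by end_near. Qed.

End regular_function.

(** * An integrable majorant on the product space *)

Section product_integrable.
Context {R : realType} (n : nat).
Local Open Scope ereal_scope.

Lemma ge0_integral_cons (g : 'rV[R]_n.+1 -> \bar R) :
  measurable_fun setT g -> (forall x, 0 <= g x) ->
  \int[lebesgue_measure_rV n.+1]_x g x =
  \int[lebesgue_measure]_t \int[lebesgue_measure_rV n]_y g (cons_rV (t, y)).
Proof.
move=> mg g0.
have -> : \int[lebesgue_measure_rV n.+1]_x g x =
    \int[lebesgue_measure \x lebesgue_measure_rV n]_z (g \o @cons_rV R n) z.
  apply: etrans (ge0_integral_pushforward
    (@measurable_cons_rV R n) (lebesgue_measure \x lebesgue_measure_rV n)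
    measurableT mg _) _ => //.
rewrite fubini_tonelli1// => [|z]; last exact: g0.
by apply: measurableT_comp => //; exact: measurable_cons_rV.
Qed.

Definition box (M : R) : set 'rV[R]_n :=
  [set y | forall i, `[(- M)%R, M]%classic (y ord0 i)].

Lemma measurable_box M : measurable (box M).
Proof.
rewrite [X in measurable X](_ : _ = \bigcap_(i in [set: 'I_n])
    ((fun x : 'rV[R]_n => x ord0 i) @^-1` `[(- M)%R, M])).
  apply: fin_bigcap_measurable => // i _.
  by rewrite -[X in measurable X]setTI; exact: measurable_coord.
by apply/seteqP; split=> [x Ax i _|x Ax i]; [exact: Ax|exact: (Ax i)].
Qed.

Lemma box_lty M : lebesgue_measure_rV n (box M) < +oo.
Proof.
rewrite (lebesgue_measure_rV_box (fun=> measurable_itv _)).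
rewrite -ge0_fin_numE; last by apply: prode_ge0 => i _; exact: measure_ge0.
elim/big_ind : _ => // [x y xfin yfin|i _]; first exact: fin_numM.
rewrite [X in X \is a _](@lebesgue_measure_itv R `[(- M)%R, M])/=.
by case: ifP.
Qed.

Definition majorant (C M : R) (x : 'rV[R]_n.+1) : R :=
  (C / oneDsqr (uncons_rV x).1 * \1_(box M) (uncons_rV x).2)%R.

Lemma integrable_majorant C M : (0 <= C)%R ->
  (lebesgue_measure_rV n.+1).-integrable setT (EFin \o majorant C M).
Proof.
move=> C0.
have ge0 x : (0 <= majorant C M x)%R.
  by rewrite mulr_ge0// divr_ge0.
have mG : measurable_fun setT (EFin \o majorant C M).
  apply/measurable_EFinP; apply: measurable_funM.
    apply: measurable_funM => //.
    apply: (@measurableT_comp _ _ _ _ _ _ (fun t : R => (oneDsqr t)^-1)%R).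
      by apply: continuous_measurable_fun; exact: continuous_oneDsqrV.
    apply: measurableT_comp; first exact: measurable_fst.
    exact: measurable_uncons_rV.
  apply: measurableT_comp.
    apply: measurable_indic; exact: measurable_box.
  apply: measurableT_comp; first exact: measurable_snd.
  exact: measurable_uncons_rV.
apply/integrableP; split => //.
under eq_integral => x _ do rewrite gee0_abs ?lee_fin//.
rewrite ge0_integral_cons//.
have inner t :
    \int[lebesgue_measure_rV n]_y (majorant C M (cons_rV (t, y)))%:E =
    lebesgue_measure_rV n (box M) * (C%:E * (oneDsqr t)^-1%:E).
  rewrite /majorant; under eq_integral do rewrite cons_rVK /= EFinM.
  rewrite ge0_integralZl_EFin//; last 2 first.
  - by apply/measurable_EFinP; apply: measurable_indic; exact: measurable_box.
  - by rewrite divr_ge0.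
  rewrite integral_indic//; last exact: measurable_box.
  by rewrite setIT EFinM muleC.
under eq_integral => t _ do rewrite inner.
have m0 : 0 <= lebesgue_measure_rV n (box M) by exact: measure_ge0.
have mV : measurable_fun [set: R] (fun t : R => ((oneDsqr t)^-1)%:E : \bar R).
  by apply/measurable_EFinP; apply: continuous_measurable_fun;
    exact: continuous_oneDsqrV.
rewrite ge0_integralZl//; last 2 first.
- exact: measurable_funeM.
- by move=> t _; rewrite mule_ge0// lee_fin// invr_ge0.
rewrite ge0_integralZl_EFin// integralT_oneDsqrV -EFinM.
apply: lte_mul_pinfty => //; last exact: ltry.
by rewrite ge0_fin_numE// box_lty.
Qed.

End product_integrable.

(** * Dominated convergence in x *)

Section energy.
Context {R : realType} (n : nat).
Variables (p : 'rV[R]_n.+1 -> 'rV[R]_n.+1 -> R) (u : 'rV[R]_n.+1 -> R).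
Variables (pm P L M : R).
Hypotheses (p_continuous : continuous (fun z : 'rV[R]_n.+1 * _ => p z.1 z.2))
  (pm1 : 1 < pm) (p_ge : forall x y, pm <= p x y)
  (p_le : forall x y, p x y <= P).
Hypotheses (u_C2 : continuously_differentiable 2 u) (L1 : 1 <= L)
  (u_lip : forall x h, `|u (x + h *: e1 n) - u x| <= L * `|h|)
  (u_osc : forall x y, `|u y - u x| <= L) (M1 : 1 <= M)
  (u_supp : forall x, u x != 0 -> forall i, `|x ord0 i| <= M).
Local Notation mu := (@lebesgue_measure R).
Local Notation e1 := (@e1 R n).

Let D (x : 'rV[R]_n.+1) (h : R) : R := `|u (x + h *: e1) - u x|.
Let q (x : 'rV[R]_n.+1) (h : R) : R := p x (x + h *: e1).
Let s0 := pm^-1.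

Definition slice s x := ((1 - s)%:E * \int[mu]_h (kern (D x) (q x) s h)%:E)%E.

Let s0_gt0 : 0 < s0. Proof. by rewrite invr_gt0 (lt_trans ltr01). Qed.
Let s0_lt1 : s0 < 1. Proof. by rewrite invf_lt1// (lt_trans ltr01). Qed.
Let D_ge0 x h : 0 <= D x h. Proof. exact: normr_ge0. Qed.
Let q_ge1 x h : 1 <= q x h. Proof. exact: le_trans (ltW pm1) (p_ge _ _). Qed.
Let s0q x h : 1 <= s0 * q x h.
Proof. by rewrite /s0 /q mulrC ler_pdivlMr ?mul1r ?p_ge ?(lt_trans ltr01). Qed.

Lemma measurable_fun_shift d (X : measurableType d)
    (f : 'rV[R]_n.+1 * 'rV[R]_n.+1 -> R) (a : X -> 'rV[R]_n.+1) (t : X -> R) :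
  continuous f ->
  (forall j, measurable_fun setT (fun z => a z ord0 j)) ->
  measurable_fun setT t ->
  measurable_fun setT (fun z => f (a z, a z + t z *: e1)).
Proof.
move=> cf ma mt; apply: measurable_fun_continuous_rV2 => // j.
under eq_fun do rewrite !mxE.
by apply: measurable_funD => //; exact: measurable_funM.
Qed.

Let cont_u2 :
  continuous (fun z : 'rV[R]_n.+1 * 'rV[R]_n.+1 => `|u z.2 - u z.1|).
Proof.
move=> z; apply: cvg_norm; apply: cvgB.
  by apply: continuous_comp; [exact: cvg_snd|exact: (C2_continuous u_C2)].
by apply: continuous_comp; [exact: cvg_fst|exact: (C2_continuous u_C2)].
Qed.

Let mD x : measurable_fun setT (D x).
Proof.
exact: (@measurable_fun_shift _ _ _ (fun=> x) id cont_u2).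
Qed.

Let mq x : measurable_fun setT (q x).
Proof.
exact: (@measurable_fun_shift _ _ _ (fun=> x) id p_continuous).
Qed.

Let slice_ge0 s x : s <= 1 -> (0 <= slice s x)%E.
Proof.
move=> s1; rewrite mule_ge0 ?lee_fin ?subr_ge0//.
by apply: integral_ge0 => h _; rewrite lee_fin kern_ge0.
Qed.

Let measurable_inner s : measurable_fun [set: 'rV[R]_n.+1]
  (fun x => \int[mu]_h (kern (D x) (q x) s h)%:E)%E.
Proof.
pose k (z : 'rV[R]_n.+1 * measurableTypeR R) := (kern (D z.1) (q z.1) s z.2)%:E.
have mz j : measurable_fun setT
    (fun z : 'rV[R]_n.+1 * measurableTypeR R => z.1 ord0 j).
  by exact: (measurableT_comp (measurable_coord j) measurable_fst).
have mh : measurable_fun setT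
    (fun z : 'rV[R]_n.+1 * measurableTypeR R => z.2).
  exact: measurable_snd.
have mk : measurable_fun setT k.
  apply/measurable_EFinP; apply: measurable_quotient => //.
    exact: (measurable_fun_shift cont_u2 mz mh).
  exact: (measurable_fun_shift p_continuous mz mh).
apply: (@measurable_fun_fubini_tonelli_F _ _ _ _ _ mu k mk).
by move=> z; rewrite lee_fin kern_ge0.
Qed.

Let measurable_slice s : measurable_fun setT (slice s).
Proof. exact: measurable_funeM. Qed.

Lemma energyE s : s <= 1 ->
  ((1 - s)%:E * J s p u = \int[lebesgue_measure_rV n.+1]_x slice s x)%E.
Proof.
move=> s1; rewrite /J /slice ge0_integralZl_EFin//; last by rewrite subr_ge0.
by move=> x _; apply: integral_ge0 => h _; rewrite lee_fin kern_ge0.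
Qed.

(* The first term is the bound near the support times the largest value of
   1 + t^2 for |t| <= 2 M; the second is the bound for |t| > 2 M, where
   4 / t^2 <= 8 / (1 + t^2). *)
Let C := 2 * L `^ P * (1 + pi) * (1 + (2 * M) ^+ 2) + L `^ P * (16 * M).

Let M0 : 0 < M. Proof. exact: lt_le_trans M1. Qed.

Let C_ge0 : 0 <= C.
Proof.
have LP := powR_ge0 L P; have pi0 := pi_ge0 R; have M0W := ltW M0.
have M2 := sqr_ge0 (2 * M).
by apply: addr_ge0; do ?[exact: addr_ge0|apply: mulr_ge0 => //].
Qed.

(** Three regions: a transverse coordinate outside the box of half-side M,
where the whole line misses the support; |x_1| <= 2 M, where the uniform bound
is used; |x_1| > 2 M, where the decay of the kernel is. *)
Lemma slice_le_majorant s x : s0 <= s -> s < 1 ->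
  (slice s x <= (majorant C M x)%:E)%E.
Proof.
move=> s0s s1; rewrite /majorant/=.
have shift_coord h i : (x + h *: e1) ord0 (lift ord0 i) = x ord0 (lift ord0 i).
  by rewrite !mxE/= mulr0 addr0.
have shift_coord0 h : (x + h *: e1) ord0 ord0 = x ord0 ord0 + h.
  by rewrite !mxE/= mulr1.
have [xM|xM] := pselect (box M (\row_i x ord0 (lift ord0 i))); last first.
  have D0 h : D x h = 0.
    have out (y : 'rV[R]_n.+1) :
        (forall i, y ord0 (lift ord0 i) = x ord0 (lift ord0 i)) -> u y = 0.
      move=> yx; apply: contrapT => /eqP /u_supp uy; apply: xM => i.
      by rewrite mxE -yx /= in_itv/= -ler_norml; exact: uy.
    by rewrite /D !out// ?subrr ?normr0.
  rewrite indicE memNset// mulr0 /slice integral0_eq ?mule0//.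
  move=> h _; rewrite /kern D0 powR0 ?mul0r// gt_eqF//.
  exact: lt_le_trans (q_ge1 x h).
rewrite indicE mem_set// mulr1; set t := x ord0 ord0.
have o0 : 0 < oneDsqr t by rewrite (lt_le_trans ltr01)// oneDsqr_ge1.
have LP : 0 <= L `^ P by exact: powR_ge0.
have pi0 : 0 <= pi :> R by exact: pi_ge0.
have [tM|tM] := leP `|t| (2 * M).
  apply: le_trans (integral_kern_le (mD x) (mq x) L1 s0_gt0 (D_ge0 x) (u_lip x)
    (fun h => u_osc _ _) (q_ge1 x) (fun h => p_le _ _) (s0q x) s0s s1) _.
  rewrite lee_fin ler_pdivlMr// /C.
  apply: (@le_trans _ _
    (2 * L `^ P * (1 + pi) * (1 + (2 * M) ^+ 2))); last first.
    by rewrite lerDl mulr_ge0// mulr_ge0// ltW.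
  apply: ler_wpM2l; first by rewrite !mulr_ge0// addr_ge0.
  rewrite /oneDsqr lerD2l -(real_normK (num_real t)).
  by rewrite lerXn2r ?nnegrE// mulr_ge0// ltW.
apply: le_trans (integral_kern_le_far (t := t) (M := M) (mD x) (mq x) L1
    s0_gt0 (D_ge0 x) (fun h => u_osc _ _) (q_ge1 x) (fun h => p_le _ _) (s0q x)
    s0s s1 M1 tM _) _.
  move=> h th.
  have out (y : 'rV[R]_n.+1) : M < `|y ord0 ord0| -> u y = 0.
    move=> yM; apply: contrapT => /eqP /u_supp /(_ ord0); rewrite leNgt yM//.
  rewrite /D !out ?subrr ?normr0//; last by rewrite shift_coord0.
  by rewrite (le_lt_trans _ tM)// ler_peMl ?ltW// ltr1n.
have t1 : 1 <= t ^+ 2.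
  rewrite -(real_normK (num_real t)) exprn_ege1// (le_trans M1)// ltW//.
  by rewrite (le_lt_trans _ tM)// ler_peMl ?ltW// ltr1n.
rewrite lee_fin ler_pdivlMr// /C.
apply: (@le_trans _ _ (L `^ P * (16 * M))); last first.
  rewrite lerDr; have M2 := sqr_ge0 (2 * M).
  by do ?[exact: addr_ge0|apply: mulr_ge0 => //].
rewrite -!mulrA; apply: ler_wpM2l => //.
have -> : 4 * ((t ^+ 2)^-1 * (2 * (M * oneDsqr t))) =
    8 * M * (oneDsqr t / t ^+ 2) by ring.
have -> : 16 * M = 8 * M * 2 by ring.
apply: ler_wpM2l; first by rewrite mulr_ge0// ltW.
by rewrite ler_pdivrMr ?(lt_le_trans ltr01)// /oneDsqr; lra.
Qed.

Let f x := (2 / p x x * `|'D_e1 u x| `^ p x x)%:E.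

Lemma cvg_slice x : slice s x @[s --> 1^'-] --> f x.
Proof.
apply: (cvg_integral_kern (mD x) (mq x) L1 s0_gt0 (D_ge0 x) (u_lip x)
    (fun h => u_osc _ _) (q_ge1 x) (fun h => p_le _ _) (s0q x)) => //.
  exact: (cvg_difference_quotient u_C2).
have line : x + h *: e1 @[h --> (0 : R)] --> x.
  have : x + h *: e1 @[h --> (0 : R)] --> x + (0 : R) *: e1.
    apply: cvgD; first exact: cvg_cst.
    by apply: cvgZ; [exact: cvg_id|exact: cvg_cst].
  by rewrite scale0r addr0.
have c : q x h @[h --> (0 : R)] --> p x x.
  have pair : (x, x + h *: e1) @[h --> (0 : R)] --> (x, x).
    exact: (cvg_pair (cvg_cst x) line).
  exact: (cvg_comp _ _ pair (@p_continuous (x, x))).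
by apply: cvg_within_filter c.
Qed.

Lemma cvg_integral_slice_seq (v : R^nat) :
  (forall k, v k < 1) -> v k @[k --> \oo] --> (1 : R) ->
  (lebesgue_measure_rV n.+1).-integrable setT f /\
  (\int[lebesgue_measure_rV n.+1]_x slice (v k) x @[k --> \oo] -->
   \int[lebesgue_measure_rV n.+1]_x f x)%E.
Proof.
move=> v1 vcvg.
(* The majorant is valid only for s >= s0; truncating the sequence from below
   changes finitely many terms. *)
pose w k := Num.max (v k) s0.
have w1 k : w k < 1 by rewrite gt_max v1 s0_lt1.
have s0w k : s0 <= w k by rewrite le_max lexx orbT.
have wv : \forall k \near \oo, w k = v k.
  have : \forall k \near \oo, s0 < v k by apply: cvgr_gt vcvg _ _.
  by apply: filterS => k s0v; rewrite /w max_l// ltW.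
have wcvg : w k @[k --> \oo] --> (1 : R).
  apply: cvg_trans vcvg; apply: near_eq_cvg.
  by apply: filterS wv => k ->.
have wf x : slice (w k) x @[k --> \oo] --> f x.
  by move/cvge_at_leftP : (@cvg_slice x); apply.
have mf : measurable_fun [set: 'rV[R]_n.+1] f.
  exact: (emeasurable_fun_cvg (fun k => slice (w k))).
have [|||||intf _ cvgw] := @dominated_convergence _ 'rV[R]_n.+1 R
  (lebesgue_measure_rV n.+1) setT measurableT (fun k => slice (w k)) f
  (EFin \o majorant C M).
- by move=> k; exact: measurable_slice.
- exact: mf.
- by apply: aeW => x _; exact: wf.
- exact: integrable_majorant.
- apply: aeW => x k _; rewrite gee0_abs; first exact: slice_le_majorant.
  by rewrite slice_ge0// ltW.
split => //; apply: cvg_trans cvgw; apply: near_eq_cvg.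
by apply: filterS wv => k wvk; rewrite /= wvk.
Qed.

(** A limit from the left is tested on sequences, and that criterion asks for
a finite limit; one particular sequence is used beforehand to know that the
limit integrand is integrable. *)
Lemma cvg_energy : ((1 - s)%:E * J s p u)%E @[s --> 1^'-] -->
  (\int[lebesgue_measure_rV n.+1]_x f x)%E.
Proof.
have [||intf _] := @cvg_integral_slice_seq (fun k => 1 - k.+1%:R^-1).
- by move=> k; rewrite ltrBlDr ltrDl invr_gt0.
- rewrite -[X in _ --> X]subr0; apply: cvgB; first exact: cvg_cst.
  exact: cvg_harmonic.
rewrite -(fineK (integrable_fin_num measurableT intf)).
apply/cvge_at_leftP => v [v1 vcvg].
rewrite fineK; last exact: integrable_fin_num.
have [_] := cvg_integral_slice_seq v1 vcvg.
apply: cvg_trans; apply: near_eq_cvg; apply: nearW => k.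
by rewrite energyE// ltW.
Qed.

End energy.

Unset Implicit Arguments.

Theorem theorem4p5 (R : realType) (n : nat)
    (p : 'rV[R]_n.+1 -> 'rV[R]_n.+1 -> R) (u : 'rV[R]_n.+1 -> R)
    (p_gt1 : forall x y, 1 < p x y)
    (p_continuous : continuous (fun z : 'rV[R]_n.+1 * 'rV[R]_n.+1 => p z.1 z.2))
    (p_symmetric : forall x y, p x y = p y x)
    (p_inf : (1 < ereal_inf (range (fun z => (p z.1 z.2)%:E)))%E)
    (p_sup : (ereal_sup (range (fun z => (p z.1 z.2)%:E)) < +oo)%E)
    (u_C2 : continuously_differentiable 2 u)
    (u_compact : compactly_supported u) :
  ((1 - s)%:E * J s p u)%E @[s --> 1^'-] -->
  (\int[lebesgue_measure_rV n.+1]_x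
     (2 / p x x * `|'D_(e1 n) u x| `^ p x x)%:E)%E.
Proof.
set pinf := ereal_inf _ in p_inf; set psup := ereal_sup _ in p_sup.
have inf_le x y : (pinf <= (p x y)%:E)%E.
  by apply: ereal_inf_lbound; exists (x, y).
have le_sup x y : ((p x y)%:E <= psup)%E.
  by apply: ereal_sup_ubound; exists (x, y).
have pinf_fin : pinf \is a fin_num.
  rewrite fin_numE; apply/andP; split.
    by rewrite gt_eqF// (lt_trans _ p_inf)// ltNyr.
  by rewrite lt_eqF// (le_lt_trans (inf_le 0 0))// ltry.
have psup_fin : psup \is a fin_num.
  rewrite fin_numE; apply/andP; split; last by rewrite lt_eqF.
  by rewrite gt_eqF// (lt_le_trans _ (le_sup 0 0))// ltNyr.
have [M M1 suppM] := support_in_box u_compact.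
have [B1 B10 partialB] := partial_bounded u_C2 u_compact.
have [B2 B20 uB] := C2_bounded u_C2 u_compact.
(* One constant serves as Lipschitz constant along e1 (at least B1), bound on
   the oscillation of u (at least 2 B2), and is at least 1. *)
apply: (@cvg_energy R n p u (fine pinf) (fine psup)
  (1 + B1 + (B2 + B2)) M) => //.
- by rewrite -lte_fin fineK.
- by move=> x y; rewrite -lee_fin fineK.
- by move=> x y; rewrite -lee_fin fineK.
- by rewrite -addrA lerDl !addr_ge0// ltW.
- move=> x h; apply: le_trans (lipschitz_line u_C2 x h partialB) _.
  apply: ler_wpM2r => //; lra.
- move=> x y; apply: le_trans (ler_normB _ _) _.
  have := uB x; have := uB y; lra.
Qed.
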